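(* Let $p\geq 1$, let $V_1,\dots,V_p$ be pairwise disjoint finite sets, let $\mathcal{H}_i\subseteq 2^{V_i}$ be JM+ hypergraphs, $V=V_1\cup\dots\cup V_p$, and let $\mathcal{H}=\mathcal{H}_1\boxplus\dots\boxplus\mathcal{H}_p$ be their selective compound. For a position $\mathbf{x}=(\mathbf{x}^1,\dots,\mathbf{x}^p)\in\mathbb{Z}_+^{V_1}\times\dots\times\mathbb{Z}_+^{V_p}$ define $M(\mathbf{x})=\sum_{i=1}^p m(\mathbf{x}^i)$, $Y(\mathbf{x})=\sum_{i=1}^p y_{\mathcal{H}_i}(\mathbf{x}^i)$ and $h(\mathbf{x})=\sum_{i=1}^p h_{\mathcal{H}_i}(\mathbf{x}^i)$. Then the Sprague–Grundy function of Nim$_\mathcal{H}$ is $\mathcal{G}_{\mathrm{Nim}_\mathcal{H}}(\mathbf{x})=\mathcal{U}(M(\mathbf{x}),Y(\mathbf{x}),h(\mathbf{x}))$ for all positions $\mathbf{x}$.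
   Context: A hypergraph on a finite set $V$ is a family $\mathcal{H}\subseteq 2^V$ of nonempty subsets (edges) with $\bigcup_{H\in\mathcal{H}}H=V$. Positions are vectors $\mathbf{x}\in\mathbb{Z}_{+}^V$. In the game Nim$_\mathcal{H}$ (two players alternate, a player unable to move loses), a move $\mathbf{x}\to\mathbf{x}'$ consists of choosing an edge $H\in\mathcal{H}$ and passing to a position $\mathbf{x}'$ with $x'_i<x_i$ for $i\in H$ and $x'_i=x_i$ for $i\notin H$. The Sprague–Grundy function is $\mathcal{G}(\mathbf{x})=\mathrm{mex}\{\mathcal{G}(\mathbf{x}')\mid \mathbf{x}\to\mathbf{x}'\}$. The height $h_\mathcal{H}(\mathbf{x})$ is the maximum number of consecutive moves that can be made from $\mathbf{x}$. Let $m(\mathbf{x})=\min_{i\in V}x_i$, $\mathbf{e}=(1,\dots,1)$, $y_\mathcal{H}(\mathbf{x})=h_\mathcal{H}(\mathbf{x}-m(\mathbf{x})\mathbf{e})$. For integers $m,y,h$: $v(m,y)=\binom{y+1}{2}+\left(\left(m-\binom{y+1}{2}-1\right)\bmod (y+1)\right)$ and $\mathcal{U}(m,y,h)=h$ if $m\leq\binom{y+1}{2}$, $\mathcal{U}(m,y,h)=v(m,y)$ otherwise. Properties: (A) An edge is transversal if it meets every edge; $\mathcal{H}$ is transversal-free if it has no transversal edge; $\mathcal{H}_S=\{H\in\mathcal{H}\mid H\subseteq S\}$; (A) means $\mathcal{H}$ is transversal-free but for every proper $S\subsetneq V$ with $\mathcal{H}_S\neq\emptyset$, $\mathcal{H}_S$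 has an edge meeting all edges of $\mathcal{H}_S$. (B) For every position $\mathbf{x}$ with $m(\mathbf{x})>0$ there is a move $\mathbf{x}\to\mathbf{x}'$ with $m(\mathbf{x}')<m(\mathbf{x})$, $h_\mathcal{H}(\mathbf{x}')=h_\mathcal{H}(\mathbf{x})-1$, $x_i-x'_i\leq1$ for all $i$. (C) For any two distinct edges $H,H'$ there are edges $H=H_0,H_1,\dots,H_q=H'$ with $H_{i+1}\cap H_i\neq\emptyset$, $|H_{i+1}\setminus H_i|=1$, $H_i\subseteq H_0\cup H_q$ for $i=0,\dots,q-1$. JM+ means (A), (B) and (C) hold. Selective compound: $\mathcal{H}_1\boxplus\dots\boxplus\mathcal{H}_p=\{\bigcup_{i=1}^pH^i\mid H^i\in\mathcal{H}_i\cup\{\emptyset\}\}\setminus\{\emptyset\}$. *)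

(* Defs.v *)
From HB Require Import structures.
From mathcomp Require Import all_boot.

Set Implicit Arguments.
Unset Strict Implicit.
Unset Printing Implicit Defensive.

Section Nim.

Variable V : finType.
Implicit Types (H : {set {set V}}) (E S : {set V}).

Definition position := {ffun V -> nat}.
Implicit Types x y : position.

Definition hypergraph H := set0 \notin H /\ cover H = [set: V].

Definition move H : rel position := fun x x' =>
  [exists E in H, [forall v, if v \in E then x' v < x v else x' v == x v]].

(* Coordinates never increase along a move, so the options of [x] can be listed
   by filtering the positions bounded by the largest coordinate of [x]; see
   [mem_options]. *)
Definition options H x : seq position :=
  [seq x' <- [seq ([ffun v => f v : nat] : position)
                | f : {ffun V -> 'I_(\max_v x v).+1}] | move H x x'].

Fixpoint has_play H k x : bool :=
  if k is k'.+1 then has (has_play H k') (options H x) else true.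

(* Every move decreases [\sum_v x v], so no play is longer; see [heightP]. *)
Definition height H x : nat := \max_(k < (\sum_v x v).+1 | has_play H k x) k.

Lemma mex_ex (s : seq nat) : exists n, n \notin s.
Proof.
exists (\max_(i <- s) i).+1; apply/negP => /(@leq_bigmax_seq _ s xpredT id).
by move=> /(_ isT); rewrite ltnn.
Qed.

Definition mex (s : seq nat) : nat := ex_minn (mex_ex s).

Fixpoint grundy_rec H n x : nat :=
  if n is n'.+1 then mex [seq grundy_rec H n' x' | x' <- options H x] else 0.

(* The fuel [\sum_v x v] is always sufficient; see [grundyE]. *)
Definition grundy H x : nat := grundy_rec H (\sum_v x v) x.

(* The neutral element [\max_v x v] makes this the minimum of the coordinates
   when [V] is nonempty, and 0 when [V] is empty. *)
Definition minpos x : nat := \big[minn/(\max_v x v)]_v x v.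

Definition yval H x : nat := height H [ffun v => x v - minpos x].

Definition meets_all H E := forall F, F \in H -> E :&: F != set0.

Definition transversal_free H := forall E, E \in H -> ~ meets_all H E.

Definition induced H S : {set {set V}} := [set E in H | E \subset S].

Definition propA H :=
  transversal_free H /\
  forall S, S \proper [set: V] -> induced H S != set0 ->
    exists2 E, E \in induced H S & meets_all (induced H S) E.

Definition propB H :=
  forall x, 0 < minpos x ->
    exists x', [/\ move H x x', minpos x' < minpos x,
                   height H x' = height H x - 1
                 & forall v, x v - x' v <= 1].

Definition propC H :=
  forall E E', E \in H -> E' \in H -> E != E' ->
    exists (q : nat) (F : nat -> {set V}),
      [/\ F 0 = E, F q = E', forall i, i <= q -> F i \in H
        & forall i, i < q ->
            [/\ F i.+1 :&: F i != set0, #|F i.+1 :\: F i| = 1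
              & F i \subset F 0 :|: F q]].

Definition JMplus H := [/\ propA H, propB H & propC H].

Lemma moveP H x x' :
  reflect (exists2 E, E \in H & forall v,
             if v \in E then x' v < x v else x' v == x v) (move H x x').
Proof.
apply: (iffP existsP) => [[E /andP[EH /forallP hE]]|[E EH hE]]; exists E => //.
by rewrite EH; apply/forallP.
Qed.

Lemma move_le H x x' : move H x x' -> forall v, x' v <= x v.
Proof.
by case/moveP => E _ hE v; move: (hE v); case: ifP => _ => [/ltnW|/eqP->].
Qed.

Lemma mem_options H x x' : (x' \in options H x) = move H x x'.
Proof.
rewrite mem_filter andb_idr // => /move_le le_x'.
have lt_x' v : x' v < (\max_v x v).+1.
  by rewrite ltnS (leq_trans (le_x' v)) // leq_bigmax.
apply/imageP; exists [ffun v => Ordinal (lt_x' v)] => //.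
by apply/ffunP => v; rewrite !ffunE.
Qed.

Lemma move_sum H x x' :
  set0 \notin H -> move H x x' -> \sum_v x' v < \sum_v x v.
Proof.
move=> H0 xx'; have le_x' := move_le xx'; case/moveP: xx' => E EH hE.
have /set0Pn[v vE] : E != set0 by apply: contraNneq H0 => <-.
rewrite (bigD1 v) //= [ltnRHS](bigD1 v) //= -addSn leq_add ?leq_sum //.
by move: (hE v); rewrite vE.
Qed.

Lemma has_playP H k x :
  reflect (exists2 s, path (move H) x s & size s = k) (has_play H k x).
Proof.
elim: k x => [|k IH] x /=; first by left; exists [::].
apply: (iffP hasP) => [[x' xx' /IH[s ps <-]]|[[|x' s] //= /andP[xx' ps] [sk]]].
  by exists (x' :: s); rewrite //= -mem_options xx'.
by exists x'; [rewrite mem_options|apply/IH; exists s].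
Qed.

Lemma play_bound H x s :
  set0 \notin H -> path (move H) x s -> size s <= \sum_v x v.
Proof.
move=> H0; elim: s x => //= x' s IH x /andP[/(move_sum H0) lt_x' /IH le_s].
exact: leq_ltn_trans le_s lt_x'.
Qed.

Lemma heightP H x : set0 \notin H ->
  (exists2 s, path (move H) x s & size s = height H x) /\
  (forall s, path (move H) x s -> size s <= height H x).
Proof.
move=> H0; split.
  apply/has_playP; rewrite /height.
  apply: (big_ind (fun k => has_play H k x)) => // m n Pm Pn.
  by rewrite /maxn; case: ifP.
move=> s ps; have lt_s : size s < (\sum_v x v).+1 by rewrite ltnS (play_bound H0).
apply: (@leq_bigmax_cond _ _ (fun k : 'I__ => k : nat) (Ordinal lt_s)).
by apply/has_playP; exists s.
Qed.

Lemma grundyE H x : set0 \notin H ->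
  grundy H x = mex [seq grundy H x' | x' <- options H x].
Proof.
move=> H0.
have indep n m (y : position) : \sum_v y v <= n -> \sum_v y v <= m ->
    grundy_rec H n y = grundy_rec H m y.
  have noopt (z : position) : \sum_v z v = 0 -> options H z = [::].
    move=> z0; case E: (options H z) => [//|z' s].
    have : z' \in options H z by rewrite E mem_head.
    by rewrite mem_options => /(move_sum H0); rewrite z0.
  have mex0 : mex [::] = 0.
    by rewrite /mex; case: ex_minnP => k _ /(_ 0 isT); case: k.
  elim: n m y => [|n IH] [|m] y //=.
  - by rewrite leqn0 => /eqP/noopt-> _; rewrite mex0.
  - by move=> _; rewrite leqn0 => /eqP/noopt->; rewrite mex0.
  move=> yn ym; congr mex; apply/eq_in_map => y'.
  rewrite mem_options => /(move_sum H0) lt_y'.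
  by apply: IH; rewrite -ltnS; apply: leq_trans lt_y' _.
rewrite /grundy (indep _ (\sum_v x v).+1) //=; congr mex.
apply/eq_in_map => x'; rewrite mem_options => /(move_sum H0) lt_x'.
by apply: indep => //; apply: ltnW.
Qed.

Lemma minposP x : 0 < #|V| ->
  (exists v, minpos x = x v) /\ (forall v, minpos x <= x v).
Proof.
move=> V0; split.
  rewrite /minpos; elim/big_ind: _ => [|_ _ [u ->] [v ->]|v _].
  - by case: (eq_bigmax (fun v => x v) V0) => v ->; exists v.
  - by rewrite /minn; case: ifP; [exists u|exists v].
  - by exists v.
move=> v; rewrite /minpos; move: (\max_u x u) => d.
have : v \in index_enum V by rewrite mem_index_enum.
elim: (index_enum V) => //= u s IH; rewrite inE big_cons.
case/predU1P => [->|/IH]; first exact: geq_minl.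
by move=> le_v; apply: leq_trans (geq_minr _ _) le_v.
Qed.

End Nim.

(* In the second branch of [calU] one has ['C(y.+1, 2) < m], so the subtractions
   in [vval] are never truncated there. *)
Definition vval (m y : nat) : nat :=
  'C(y.+1, 2) + (m - 'C(y.+1, 2) - 1) %% y.+1.

Definition calU (m y h : nat) : nat :=
  if m <= 'C(y.+1, 2) then h else vval m y.

(* The union of the pairwise disjoint sets V_i is the sigma type of the V_i. *)
Definition selective_compound (p : nat) (V : 'I_p -> finType)
    (H : forall i, {set {set V i}}) : {set {set {i : 'I_p & V i}}} :=
  [set \bigcup_i [set Tagged (fun i => V i : Type) v | v in F i]
    | F : {dffun forall i, {set V i}} in setXn (fun i => set0 |: H i)] :\ set0.

Definition component (p : nat) (V : 'I_p -> finType)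
    (x : position {i : 'I_p & V i}) (i : 'I_p) : position (V i) :=
  [ffun v => x (Tagged (fun i => V i : Type) v)].

(* Main.v *)
(* A position is "long" when M <= C(Y + 1, 2) and "short" otherwise; write M', Y'
   for the values after a move. Since no edge is transversal, a move that lowers
   M by K leaves Y' >= K, which together with h >= Y + 2 M shows that no move
   preserves U. Conversely, by (A) and (C), a short position of value t < M is
   reached by taking Y' to be the index of the block [C(y + 1, 2), C(y + 2, 2))
   containing t and M' <= M the largest number congruent to t + 1 modulo
   Y' + 1; only long positions have a value t >= M to be reached, and (B) gives
   a slow move from which the height goes down one by one to M through
   positions with Y' >= Y and then through positions with M' = 0, all long.
   Heights are handled as maximum packings of edges. *)

Require Import Defs.
From HB Require Import structures.
From mathcomp Require Import all_boot zify.

Set Implicit Arguments.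
Unset Strict Implicit.
Unset Printing Implicit Defensive.

(** * Operations on positions and discrete intermediate values *)

Section Positions.

Variable V : finType.
Implicit Types (x w a b : position V) (E F : {set V}) (v : V).

Definition dec x E : position V := [ffun v => x v - (v \in E)].

Definition clear x E : position V := [ffun v => if v \in E then 0 else x v].

Definition lower x c : position V := [ffun v => x v - c].

Definition raise x c : position V := [ffun v => x v + c].

(** Descending from [b] to [a] by unit decrements, [f] drops by at most 1 per step and so cannot
    skip [t]. *)
Lemma position_ivt (f : position V -> nat) a b t :
    (forall x v, f x <= (f (dec x [set v])).+1) ->
    (forall v, a v <= b v) -> f a <= t <= f b ->
  exists w, [/\ forall v, a v <= w v, forall v, w v <= b v & f w = t].
Proof.
move=> fdec; have [n] := ubnP (\sum_v b v).
elim: n b => // n IH b bn ab /andP[fat tfb].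
have [e|ne] := eqVneq (f b) t; first by exists b; split.
have [v ltv] : exists v, a v < b v.
  apply/existsP; apply: contraT; rewrite negb_exists => /forallP h.
  suff eab : a = b by move: ne; rewrite eab in fat; lia.
  by apply/ffunP => v; apply/eqP; rewrite eqn_leq ab leqNgt h.
have ltd : \sum_u dec b [set v] u < \sum_u b u.
  rewrite (bigD1 v) //= [ltnRHS](bigD1 v) //= ffunE inE eqxx -addSn leq_add //.
    by rewrite subn1 prednK // (leq_ltn_trans _ ltv).
  by apply: leq_sum => u _; rewrite ffunE leq_subr.
have [|||w [aw wb fw]] := IH (dec b [set v]).
- by apply: leq_trans ltd _; rewrite -ltnS.
- by move=> u; rewrite ffunE inE; case: eqP => [->|_]; move: (ab u) ltv; lia.
- by move: (fdec b v) ne; lia.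
by exists w; split=> // u; apply: leq_trans (wb u) _; rewrite ffunE leq_subr.
Qed.

Lemma minpos_unique x v c : x v = c -> (forall u, c <= x u) -> minpos x = c.
Proof.
move=> xv le_c; have V0 : 0 < #|V| by apply/card_gt0P; exists v.
have [[u eu] le_m] := minposP x V0.
by apply/eqP; rewrite eqn_leq -{1}xv le_m eu le_c.
Qed.

Lemma minpos_eq0 x v : x v = 0 -> minpos x = 0.
Proof. by move=> xv; apply: (minpos_unique xv). Qed.

Lemma minpos_le x v : minpos x <= x v.
Proof.
have V0 : 0 < #|V| by apply/card_gt0P; exists v.
exact: (minposP x V0).2.
Qed.

Lemma minpos_mono x w : (forall v, x v <= w v) -> minpos x <= minpos w.
Proof.
move=> xw; have [V0|] := posnP #|V|; last first.
  by move=> V0; have [[u ->] _] := minposP w V0; apply: leq_trans (minpos_le _ _) _.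
have e : x = w by apply/ffunP => v; move/card0_eq: V0 => /(_ v).
by rewrite e.
Qed.

Lemma raise_lower x c : c <= minpos x -> raise (lower x c) c = x.
Proof.
move=> cx; apply/ffunP => v; rewrite !ffunE subnK //.
exact: leq_trans cx (minpos_le _ _).
Qed.

Lemma raiseK x c : lower (raise x c) c = x.
Proof. by apply/ffunP => v; rewrite !ffunE addnK. Qed.

End Positions.

(** * Heights as maximum packings of edges *)

Section Height.

Variables (V : finType) (H : {set {set V}}).
Implicit Types (x w a b : position V) (E F : {set V}) (v : V).

Definition move_by E x w := forall v, if v \in E then w v < x v else w v == x v.

Lemma move_by_move E x w : E \in H -> move_by E x w -> move H x w.
Proof. by move=> EH Exw; apply/moveP; exists E. Qed.

Lemma move_by_between E x w a :
    move_by E x w -> (forall v, a v <= w v) ->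
    (forall v, v \notin E -> w v <= a v) ->
  move_by E x a.
Proof.
move=> Exw aw wa v; move: (Exw v) (aw v) (wa v); case: ifP => // _; first lia.
by move=> /eqP <- ? /(_ isT) ?; rewrite eqn_leq; apply/andP.
Qed.

Lemma move_by_dec E x : (forall v, v \in E -> 0 < x v) -> move_by E x (dec x E).
Proof.
by move=> xE v; move: (xE v); rewrite ffunE; case: (v \in E) => [/(_ isT)|_]; lia.
Qed.

Lemma raise_move x w c : move H x w -> move H (raise x c) (raise w c).
Proof.
case/moveP=> E EH Exw; apply/moveP; exists E => // v.
by move: (Exw v); rewrite !ffunE ltn_add2r eqn_add2r.
Qed.

(** A multiset of edges, order being irrelevant: this makes monotonicity and superadditivity of the
    height easy. *)
Definition packing x (s : seq {set V}) :=
  {subset s <= H} /\ forall v, count (fun E => v \in E) s <= x v.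

Lemma packing_cons_gt0 x E s : packing x (E :: s) -> forall v, v \in E -> 0 < x v.
Proof. by case=> _ cs v vE; move: (cs v); rewrite /= vE; lia. Qed.

Lemma packing_behead x E s : packing x (E :: s) -> packing (dec x E) s.
Proof.
case=> sH cs; split=> [F Fs|v]; first by apply: sH; rewrite inE Fs orbT.
by move: (cs v); rewrite ffunE /=; case: (v \in E); lia.
Qed.

Lemma packing_play x s :
  packing x s -> exists2 p, path (move H) x p & size p = size s.
Proof.
elim: s x => [|E s IH] x xs; first by exists [::].
have [p pp sp] := IH _ (packing_behead xs).
exists (dec x E :: p); rewrite /= ?sp // pp andbT.
apply: (move_by_move (E := E)); first by apply: xs.1; rewrite mem_head.
exact/move_by_dec/(packing_cons_gt0 xs).
Qed.

Lemma move_packing E x w s :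
  E \in H -> move_by E x w -> packing w s -> packing x (E :: s).
Proof.
move=> EH Exw [sH cs]; split=> [F|v]; first by rewrite inE => /predU1P[->|/sH].
move: (cs v) (Exw v) => /=; case: ifP => _; first lia.
by move=> + /eqP <-.
Qed.

Lemma play_packing x p :
  path (move H) x p -> exists2 s, packing x s & size s = size p.
Proof.
elim: p x => [|w p IH] x /=; first by exists [::].
case/andP=> /moveP[E EH Exw] /IH[s ws ss].
by exists (E :: s); rewrite /= ?ss //; apply: move_packing ws.
Qed.

Hypothesis H0 : set0 \notin H.

Lemma move_irrefl x : ~~ move H x x.
Proof. by apply/negP => /(move_sum H0); rewrite ltnn. Qed.

Lemma packing_height x s : packing x s -> size s <= height H x.
Proof. by case/packing_play => p pp <-; apply: (heightP x H0).2. Qed.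

Lemma height_packing x : exists2 s, packing x s & size s = height H x.
Proof.
have [[p pp <-] _] := heightP x H0.
exact: play_packing.
Qed.

Lemma height_mono x w : (forall v, x v <= w v) -> height H x <= height H w.
Proof.
move=> xw; have [s [sH cs] <-] := height_packing x.
by apply: packing_height; split=> // v; apply: leq_trans (cs v) _.
Qed.

(** It suffices to drop from a maximum packing one edge through [v], if there is any. *)
Lemma height_dec1 x v : height H x <= (height H (dec x [set v])).+1.
Proof.
have [s [sH cs] <-] := height_packing x.
have [/hasP[E Es vE]|/hasPn nv] := boolP (has (fun E => v \in E) s).
  have ps := perm_to_rem Es.
  rewrite (perm_size ps) ltnS; apply: packing_height; split=> [F /mem_rem/sH //|u].
  move: (cs u); rewrite ffunE inE (permP ps) /=.
  by case: eqP => [->|_]; rewrite ?vE; lia.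
apply/leqW/packing_height; split=> // u; rewrite ffunE inE.
case: eqP => [->|_]; last by rewrite subn0.
by rewrite (eq_in_count (a2 := pred0)) ?count_pred0 // => E /nv/negbTE.
Qed.

Lemma height_add x w b :
  (forall v, x v + w v <= b v) -> height H x + height H w <= height H b.
Proof.
move=> xw; have [s [sH cs] <-] := height_packing x.
have [s' [sH' cs'] <-] := height_packing w.
rewrite -size_cat; apply: packing_height; split=> [E|v].
  by rewrite mem_cat => /orP[/sH|/sH'].
by rewrite count_cat; move: (cs v) (cs' v) (xw v); lia.
Qed.

Lemma height_edge x E k :
  E \in H -> (forall v, v \in E -> k <= x v) -> k <= height H x.
Proof.
move=> EH kE; rewrite -(size_nseq k E); apply: packing_height; split=> [F|v].
  by rewrite mem_nseq => /andP[_ /eqP->].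
by rewrite count_nseq; case: (boolP (v \in E)) => [/kE|_]; rewrite ?mul1n ?mul0n.
Qed.

Lemma move_height x w : move H x w -> height H w < height H x.
Proof.
case/moveP=> E EH Exw; have [s ws <-] := height_packing w.
exact: packing_height (move_packing EH Exw ws).
Qed.

Lemma height_first_edge x : 0 < height H x ->
  exists E, [/\ E \in H, forall v, v \in E -> 0 < x v
               & height H x <= (height H (dec x E)).+1].
Proof.
have [s xs <-] := height_packing x; case: s xs => // E s xs _.
exists E; split; [by apply: xs.1; rewrite mem_head| exact: packing_cons_gt0 xs|].
exact/packing_height/packing_behead.
Qed.

(** Each edge of a packing of [clear x E] avoids [E] and lies in the support of [x], so it contains
    [v]; at most [x v] edges can. *)
Lemma height_clear_le x E v :
    (forall F, F \in H -> (forall u, u \in F -> 0 < x u) ->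
       E :&: F == set0 -> v \in F) ->
  height H (clear x E) <= x v.
Proof.
move=> hE; have [s [sH cs] <-] := height_packing (clear x E).
apply: leq_trans (leq_trans (cs v) _); last by rewrite ffunE; case: ifP.
rewrite -count_predT; apply/eq_leq/eq_in_count => F Fs; apply/esym.
have Fpos u : u \in F -> 0 < clear x E u.
  move=> uF; apply: leq_trans (cs u); rewrite -has_count.
  by apply/hasP; exists F.
apply: hE (sH _ Fs) _ _ => [u /Fpos|]; first by rewrite ffunE; case: ifP.
apply/set0Pn => -[u]; rewrite inE => /andP[uE /Fpos].
by rewrite ffunE uE.
Qed.

Lemma height_between a b t :
    (forall v, a v <= b v) -> height H a <= t <= height H b ->
  exists w, [/\ forall v, a v <= w v, forall v, w v <= b v & height H w = t].
Proof. exact: position_ivt height_dec1. Qed.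

End Height.

(** * Moves in a single JM+ hypergraph *)

Section JM.

Variables (V : finType) (H : {set {set V}}).
Hypotheses (hyperH : hypergraph H) (jmH : JMplus H).
Implicit Types (x w a b : position V) (D E F : {set V}) (v : V).

Let H0 : set0 \notin H := hyperH.1.

Lemma disjoint_edge E : E \in H -> exists2 F, F \in H & E :&: F = set0.
Proof.
have [[tfH _] _ _] := jmH => EH.
have [/exists_inP[F FH /eqP EF]|] := boolP [exists F in H, E :&: F == set0].
  by exists F.
rewrite negb_exists_in => /forall_inP h; case: (tfH E EH) => F FH; exact: h.
Qed.

Lemma edge_through v : exists2 E, E \in H & v \in E.
Proof. by apply/bigcupP; have := in_setT v; rewrite -hyperH.2. Qed.

(** Differs from [minpos w = 0] only on an empty vertex set. *)
Definition vanishes w := exists v, w v = 0.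

(** As [D] lies in [E], every position between [clear w D] and [w] also results from [x] by a move
    along [E]. *)
Lemma move_by_heights E x w D t :
    E \in H -> move_by E x w -> vanishes w -> D \subset E ->
    height H (clear w D) <= t <= height H w ->
  exists w', [/\ move H x w', vanishes w' & height H w' = t].
Proof.
move=> EH Exw [v wv] DE ht.
have [u|w' [ge_w' le_w' <-]] := height_between H0 _ ht.
  by rewrite ffunE; case: ifP.
exists w'; split=> //; last by exists v; move: (le_w' v); rewrite wv; lia.
apply: (move_by_move EH); apply: move_by_between Exw le_w' _ => u uE.
apply: leq_trans (ge_w' u); rewrite ffunE; case: ifP => // uD.
by move/subsetP: DE uE => /(_ u uD) ->.
Qed.

(* Passing from an edge to the next one in a chain given by (C), the position
   with the common part cleared can be kept: only the unique new vertex has to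
   be decreased, which costs at most 1 in height. *)
Lemma chain_heights x E E' w t :
    E \in H -> E' \in H -> (forall v, v \in E :|: E' -> 0 < x v) ->
    move_by E x w -> vanishes w ->
    height H (clear x E') <= t <= height H w ->
  exists w', [/\ move H x w', vanishes w' & height H w' = t].
Proof.
move=> EH E'H xpos Exw w0 /andP[letx tlew].
have [_ _ propCH] := jmH.
have [q [F [F0 Fq FH Fstep]]] : exists (q : nat) (F : nat -> {set V}),
    [/\ F 0 = E, F q = E', forall i, i <= q -> F i \in H
      & forall i, i < q ->
          [/\ F i.+1 :&: F i != set0, #|F i.+1 :\: F i| = 1
            & F i \subset F 0 :|: F q]].
  (* (C) speaks of distinct edges only; equal ones get the chain of length 0. *)
  have [<-|] := eqVneq E E'; last exact: propCH.
  by exists 0, (fun=> E); split.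
have Fpos i v : i <= q -> v \in F i -> 0 < x v.
  move=> iq vFi; apply: xpos; rewrite -F0 -Fq.
  move: iq; rewrite leq_eqVlt => /predU1P[iq|/Fstep[_ _ /subsetP]]; last exact.
  by rewrite inE -iq vFi orbT.
have {Exw}: move_by (F 0) x w by rewrite F0.
have : 0 + q = q by [].
move: {1}q 0 => n i; elim: n i w w0 tlew => [|n IH] i w w0 tlew iq Fiw.
  rewrite addn0 in iq; subst i.
  apply: (move_by_heights (D := E') E'H _ w0); rewrite -?Fq // tlew andbT.
  apply: leq_trans _ letx; rewrite Fq; apply: height_mono => // v; rewrite !ffunE.
  by case: ifP => // vE'; have := Fiw v; rewrite Fq vE' => /eqP ->.
have lt_iq : i < q by lia.
have [/set0Pn[c cI] /eqP/cards1P[u eu] _] := Fstep i lt_iq.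
set D := F i.+1 :&: F i in cI.
have [le_t|gt_t] := leqP (height H (clear w D)) t.
  apply: (move_by_heights (FH i (ltnW lt_iq)) Fiw w0 (D := D)).
    exact: subsetIr.
  by rewrite le_t.
have uF : u \in F i.+1 :\: F i by rewrite eu set11.
(* As [F i.+1] is [D] plus the vertex [u], [w2] results from a move along [F i.+1]. It vanishes on
   the nonempty [D], and its height is at least that of [clear w D] minus 1, hence at least [t]. *)
pose w2 := dec (clear x D) [set u].
apply: (IH i.+1 w2); last 2 first.
- lia.
- move=> v; rewrite !ffunE inE; have [vF|vF] := ifP.
    have xv := Fpos i.+1 v lt_iq vF; have [->|nu] := eqVneq v u.
      have := Fpos i.+1 u lt_iq (subsetP (subsetDl _ _) _ uF).
      by case: ifP => _ //=; lia.
    have -> : v \in D.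
      by apply: contraNT nu; rewrite inE vF /= => vFi; rewrite -in_set1 -eu inE vFi.
    lia.
  rewrite inE vF /=; have /negPf-> : v != u; last by rewrite subn0.
  by apply: contraFneq vF => ->; move: uF; rewrite inE => /andP[].
- exists c; by rewrite !ffunE cI.
have := height_dec1 H0 (clear w D) u.
suff : height H (dec (clear w D) [set u]) <= height H w2 by lia.
apply: height_mono => // v; rewrite !ffunE; case: ifP => // _.
apply: leq_sub2r; have := Fiw v; case: ifP => _; lia.
Qed.

(** The support [S] of [x] is proper, so (A) gives an edge [E'] meeting all edges in [S]; clearing
    it leaves height 0. The chain starts at the first edge of a maximum packing, whose removal costs
    only 1. *)
Lemma heights_of_vanishing x t :
    vanishes x -> t < height H x ->
  exists w, [/\ move H x w, vanishes w & height H w = t].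
Proof.
move=> [v xv] lt_t.
have [|E [EH Epos le_E]] := height_first_edge H0 (x := x); first lia.
have [[_ propAH] _ _] := jmH; pose S := [set u | 0 < x u].
have ES : E \in induced H S.
  by rewrite inE EH; apply/subsetP => u /Epos; rewrite inE.
have [||E' + E'meets] := propAH S.
- by rewrite properT; apply/eqP => ST; have := in_setT v; rewrite -ST inE xv.
- by apply/set0Pn; exists E.
rewrite inE => /andP[E'H /subsetP E'S].
apply: (chain_heights EH E'H _ (move_by_dec Epos)).
- by move=> u; rewrite inE => /orP[/Epos|/E'S] //; rewrite inE.
- by exists v; rewrite ffunE xv.
apply/andP; split; last lia.
apply: leq_trans (leq0n t); rewrite -xv; apply: height_clear_le => // F FH Fpos.
move/eqP; have /E'meets/eqP // : F \in induced H S.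
by rewrite inE FH; apply/subsetP => u /Fpos; rewrite inE.
Qed.

(** Let [v] be a minimal vertex. (A) on its complement gives an edge [E'] meeting every edge that
    avoids [v]; after clearing [E'], all playable edges pass through [v], so the height is at most
    [minpos x]. *)
Lemma heights_of_positive x E w t :
    0 < minpos x -> E \in H -> move_by E x w -> vanishes w ->
    minpos x <= t <= height H w ->
  exists w', [/\ move H x w', vanishes w' & height H w' = t].
Proof.
move=> x0 EH Exw w0 /andP[le_t t_le].
have [[v xv] _] : (exists v, minpos x = x v) /\ (forall v, minpos x <= x v).
  by apply: minposP; case: w0 => v _; apply/card_gt0P; exists v.
have xpos u : 0 < x u by apply: leq_trans x0 (minpos_le _ _).
have [[_ propAH] _ _] := jmH; pose S := [set~ v].
have [||E' + E'meets] := propAH S.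
- by rewrite properT; apply/eqP => ST; have := in_setT v; rewrite -ST !inE eqxx.
(* An edge disjoint from one through [v] avoids [v], so the induced family is nonempty. *)
- have [F FH vF] := edge_through v; have [F' F'H FF'] := disjoint_edge FH.
  apply/set0Pn; exists F'; rewrite inE F'H; apply/subsetP => u uF'; rewrite !inE.
  apply: contraTneq uF' => ->; apply/negP => vF'.
  by have := in_set0 v; rewrite -FF' inE vF vF'.
rewrite inE => /andP[E'H _]; apply: (chain_heights EH E'H _ Exw) => //.
rewrite t_le andbT (leq_trans _ le_t) // xv; apply: height_clear_le => // F FH _ E'F.
apply: contraTT E'F => vF; apply: E'meets; rewrite inE FH.
by apply/subsetP => u uF; rewrite !inE; apply: contraNneq vF => <-.
Qed.

(** What one move of the compound can do to a single component. *)
Definition reach x w := w = x \/ move H x w.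

Lemma reach_le x w : reach x w -> forall v, w v <= x v.
Proof. by case=> [->|/move_le]. Qed.

Lemma reach_minpos x w : reach x w -> minpos w <= minpos x.
Proof. by move=> /reach_le/minpos_mono. Qed.

Lemma reach_height x w : reach x w -> height H w <= height H x.
Proof. by move=> /reach_le/(height_mono H0). Qed.

(** An edge disjoint from the one played is untouched; after subtracting [minpos w] it can still be
    played [minpos x - minpos w] times. *)
Lemma reach_minpos_yval x w : reach x w -> minpos x <= minpos w + yval H w.
Proof.
case=> [->|/moveP[E EH Exw]]; first exact: leq_addr.
have [F FH EF] := disjoint_edge EH.
rewrite -leq_subLR; apply: (height_edge H0 FH) => v vF; rewrite ffunE.
have vE : v \notin E by apply/negP => vE; have := in_set0 v; rewrite -EF inE vE vF.
by move: (Exw v); rewrite (negPf vE) => /eqP ->; apply/leq_sub2r/minpos_le.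
Qed.

Lemma move_yval x w :
  move H x w -> minpos w = minpos x -> yval H w < yval H x.
Proof.
move=> /moveP[E EH Exw] ewx; apply: move_height => //.
apply/moveP; exists E => // v; move: (Exw v) (minpos_le w v); rewrite !ffunE ewx.
by case: ifP => _; lia.
Qed.

Lemma minpos_card0 x : #|V| = 0 -> minpos x = 0.
Proof.
move/card0_eq => V0; rewrite /minpos big_pred0; last by move=> v; have := V0 v.
by rewrite big_pred0 // => v; have := V0 v.
Qed.

(** The factor 2 comes from two disjoint edges, each played [minpos x] times in the constant part of
    [x]. *)
Lemma yval_minpos_height x : yval H x + (minpos x).*2 <= height H x.
Proof.
have [V0|/card_gt0P[v _]] := posnP #|V|.
  rewrite (minpos_card0 x V0) addn0; apply: height_mono => // v.
  by rewrite ffunE leq_subr.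
have [E EH _] := edge_through v; have [F FH EF] := disjoint_edge EH.
pose c D : position V := [ffun u => minpos x * (u \in D)].
have cE D : D \in H -> minpos x <= height H (c D).
  by move=> DH; apply: (height_edge H0 DH) => u uD; rewrite ffunE uD muln1.
have cEF : height H (c E) + height H (c F) <= height H [ffun u => minpos x].
  apply: height_add => // u; rewrite !ffunE; case: (boolP (u \in E)) => uE; last lia.
  suff /negPf-> : u \notin F by lia.
  by apply/negP => uF; have := in_set0 u; rewrite -EF inE uE uF.
have : yval H x + height H [ffun u => minpos x] <= height H x.
  by apply: height_add => // u; rewrite !ffunE subnK ?minpos_le.
by move: (cE E EH) (cE F FH); lia.
Qed.

(** * Prescribing the minimum, [yval] or the height after a move *)

Lemma minpos_raise w c : vanishes w -> minpos (raise w c) = c.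
Proof.
case=> v wv; apply: (minpos_unique (v := v)); first by rewrite ffunE wv.
by move=> u; rewrite ffunE leq_addl.
Qed.

Lemma yval_raise w c : vanishes w -> yval H (raise w c) = height H w.
Proof. by move=> w0; rewrite /yval minpos_raise // -/(lower _ _) raiseK. Qed.

Lemma yval_vanishes w : vanishes w -> yval H w = height H w.
Proof.
case=> v wv; rewrite /yval (minpos_eq0 wv); congr height.
by apply/ffunP => u; rewrite ffunE subn0.
Qed.

Lemma height_gt0_card x : 0 < height H x -> 0 < #|V|.
Proof.
case/(height_first_edge H0) => E [EH _ _].
have /set0Pn[v _] : E != set0 by apply: contraNneq H0 => <-.
by apply/card_gt0P; exists v.
Qed.

Lemma reach_min_yval x k t :
    k <= minpos x -> k <= t <= maxn k (yval H x) ->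
  exists w, [/\ reach x w, minpos w = minpos x - k & yval H w = t].
Proof.
have [->|k0] := posnP k.
  move=> _; rewrite max0n => /= le_t; rewrite subn0.
  have [->|ne] := eqVneq t (yval H x); first by exists x; split=> //; left.
  have {le_t ne} lt_t : t < yval H x by rewrite ltn_neqAle ne.
  have /(minposP x)[[v xv] _] : 0 < #|V|.
    by apply: height_gt0_card (leq_ltn_trans _ lt_t).
  have l0 : vanishes (lower x (minpos x)) by exists v; rewrite ffunE xv subnn.
  have [w [lw w0 <-]] := heights_of_vanishing l0 lt_t.
  exists (raise w (minpos x)); split; rewrite ?minpos_raise ?yval_raise //; right.
  by rewrite -{1}[x](raise_lower (leqnn _)); apply: raise_move.
move=> km /andP[kt t_le].
have V0 : 0 < #|V|.
  by rewrite lt0n; apply: contraTneq km => /(minpos_card0 x) ->; rewrite -ltnNge.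
have [[v xv] xge] := minposP x V0; have [E EH vE] := edge_through v.
(* The target minimum [c] is subtracted, a move from [z] to a vanishing position is found, and [c]
   is added back. *)
pose c := minpos x - k; pose z := lower x c.
have zv : z v = k by rewrite ffunE -xv subKn.
have zmin : minpos z = k.
  by apply: minpos_unique zv _ => u; rewrite ffunE; move: (xge u); lia.
pose w0 := clear (dec z E) [set v].
have Ezw0 : move_by E z w0.
  have zE u : u \in E -> 0 < z u by move=> _; rewrite ffunE; move: (xge u); lia.
  apply: (move_by_between (move_by_dec zE)) => u;
    rewrite !ffunE in_set1; case: eqP => //.
  by move=> ->; rewrite vE.
have van0 : vanishes w0 by exists v; rewrite ffunE set11.
have t_w0 : t <= height H w0.
  apply: leq_trans t_le _; rewrite geq_max; apply/andP; split.
    rewrite -zmin; have := reach_minpos_yval (or_intror (move_by_move EH Ezw0)).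
    by case: (van0) => u /minpos_eq0 ->; rewrite yval_vanishes.
  (* Since [0 < k], subtracting [minpos x] from [x] costs at least [c + 1] everywhere, so the result
     lies below [w0]. *)
  apply: height_mono => // u; rewrite !ffunE inE; case: eqP => [->|_].
    by rewrite -xv subnn.
  by move: (xge u); case: (u \in E); lia.
have [||w [zw wvan <-]] := heights_of_positive (t := t) _ EH Ezw0 van0.
- by rewrite zmin.
- by rewrite zmin kt.
exists (raise w c); split; rewrite ?minpos_raise ?yval_raise //; right.
by rewrite -[x](raise_lower (leq_subr k _)); apply: raise_move.
Qed.

(* Starting from the slow move of (B), lowering a vertex of minimum value down
   to 0 never brings [yval] below [yval H x]; from then on the minimum is 0. *)
Lemma reach_heights x : exists a : nat,
  [/\ minpos x <= a <= height H x,
      forall t, a <= t <= height H x ->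
        exists w, [/\ reach x w, height H w = t & yval H x <= yval H w]
    & forall t, minpos x <= t <= a ->
        exists w, [/\ reach x w, height H w = t & minpos w = 0]].
Proof.
have [m0|m0] := posnP (minpos x).
  exists (height H x); split; rewrite ?m0 ?leqnn // => t.
    by rewrite -eqn_leq => /eqP <-; exists x; split=> //; left.
  move=> /= le_t; have [->|ne] := eqVneq t (height H x).
    by exists x; split=> //; left.
  have {le_t ne} lt_t : t < height H x by rewrite ltn_neqAle ne.
  have /(minposP x)[[v xv] _] : 0 < #|V|.
    by apply: height_gt0_card (leq_ltn_trans _ lt_t).
  have [|w [xw [u wu] <-]] := heights_of_vanishing _ lt_t.
    by exists v; rewrite -xv.
  by exists w; split=> //; [right|exact: minpos_eq0 wu].
have [_ propBH _] := jmH; have [x' [xx' lt_m hx' slow]] := propBH x m0.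
have V0 : 0 < #|V|.
  by rewrite lt0n; apply: contraTneq m0 => /(minpos_card0 x) ->.
have [[v x'v] _] := minposP x' V0; have le_x' := move_le xx'.
(* The minimum drops while no coordinate drops by more than 1, so a minimal vertex of [x'] was
   minimal in [x]. *)
have xv : x v = minpos x.
  by apply/eqP; rewrite eqn_leq minpos_le andbT; move: (slow v); rewrite -x'v; lia.
case/moveP: (xx') => E EH Exx'; pose w0 := clear x' [set v].
have vE : v \in E by move: (Exx' v); case: ifP => // _ /eqP; lia.
have le_w0 u : w0 u <= x' u by rewrite ffunE; case: ifP.
have between w : (forall u, w0 u <= w u) -> (forall u, w u <= x' u) -> move_by E x w.
  move=> w0w wx'; apply: (move_by_between Exx') => // u uE.
  apply: leq_trans (w0w u); rewrite ffunE inE; case: eqP => // uv.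
  by rewrite uv vE in uE.
have van0 : vanishes w0 by exists v; rewrite ffunE set11.
have Exw0 := between w0 (fun=> leqnn _) le_w0.
have xw0 := or_intror (move_by_move EH Exw0) : reach x w0.
exists (height H w0); split.
- rewrite reach_height // andbT; apply: leq_trans (reach_minpos_yval xw0) _.
  by case: (van0) => u /minpos_eq0 ->; rewrite yval_vanishes.
- move=> t /andP[a_t t_h]; have [->|ne] := eqVneq t (height H x).
    by exists x; split=> //; left.
  have [|w [w0w wx' wt]] := height_between H0 le_w0 (t := t).
    by rewrite a_t hx'; move: ne; lia.
  exists w; split=> //; first by right; apply: move_by_move EH (between w w0w wx').
  (* Here [minpos w] is at most [minpos x - 1], and coordinates other than [v] lose at most 1, so
     the excess over the minimum does not shrink. *)
  have wv : minpos w <= w v := minpos_le w v.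
  apply: height_mono => // u; rewrite !ffunE.
  have [->|nuv] := eqVneq u v; first by rewrite xv subnn.
  have := w0w u; rewrite ffunE inE (negPf nuv); move: (slow u) (wx' v) (wx' u).
  by rewrite -x'v; lia.
- move=> t /(heights_of_positive m0 EH Exw0 van0)[w [xw [u wu] <-]].
  by exists w; split=> //; [right|exact: minpos_eq0 wu].
Qed.

End JM.

(** * Characterization of the Sprague-Grundy function *)

Section Grundy.

Variables (V : finType) (H : {set {set V}}).

Lemma mex_eq (s : seq nat) n :
  n \notin s -> (forall k, k < n -> k \in s) -> mex s = n.
Proof.
move=> ns lt_s; rewrite /mex; case: ex_minnP => m ms min_m.
apply/eqP; rewrite eqn_leq min_m //= leqNgt; apply/negP => /lt_s.
by rewrite (negPf ms).
Qed.

Lemma grundy_unique (f : position V -> nat) : set0 \notin H ->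
    (forall x w, move H x w -> f w != f x) ->
    (forall x t, t < f x -> exists2 w, move H x w & f w = t) ->
  forall x, grundy H x = f x.
Proof.
move=> H0 f_neq f_lt x; have [n] := ubnP (\sum_v x v).
elim: n x => // n IH x lt_n; rewrite grundyE //.
have -> : [seq grundy H w | w <- options H x] = [seq f w | w <- options H x].
  apply/eq_in_map => w; rewrite mem_options => /(move_sum H0) lt_w.
  by apply: IH; apply: leq_trans lt_w _.
apply: mex_eq => [|t /f_lt[w xw <-]]; last by apply: map_f; rewrite mem_options.
by apply/mapP => -[w]; rewrite mem_options => /f_neq/eqP ne e; apply: ne.
Qed.

End Grundy.

(** * Arithmetic of triangular blocks and distribution of sums *)

Lemma triangular_block t :
  exists y r, r <= y /\ t = 'C(y.+1, 2) + r.
Proof.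
elim: t => [|t [y [r [ry ->]]]]; first by exists 0, 0.
have [lt|ge] := ltnP r y; first by exists y, r.+1; rewrite addnS.
by exists y.+1, 0; split=> //; rewrite [in RHS]binS bin1; lia.
Qed.

Lemma triangular_mono y y' : y <= y' -> 'C(y.+1, 2) <= 'C(y'.+1, 2).
Proof. by move=> le_y; apply: leq_bin2l. Qed.

Lemma triangular_ltn y y' : y < y' -> 'C(y.+1, 2) + y < 'C(y'.+1, 2).
Proof. by move/triangular_mono; rewrite binS bin1; lia. Qed.

Lemma triangular_block_inj y y' r r' :
  r <= y -> r' <= y' -> 'C(y.+1, 2) + r = 'C(y'.+1, 2) + r' -> y = y'.
Proof.
move=> ry ry' e; case: (ltngtP y y') => // /triangular_ltn; lia.
Qed.

Lemma vval_lt m y : 'C(y.+1, 2) < m -> vval m y < m.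
Proof.
by rewrite /vval => lt_m; have := leq_mod (m - 'C(y.+1, 2) - 1) y.+1; lia.
Qed.

Lemma calU_short y r q h :
  r <= y -> calU (('C(y.+1, 2) + r).+1 + q * y.+1) y h = 'C(y.+1, 2) + r.
Proof.
move=> ry; rewrite /calU ifF; last lia.
rewrite /vval; congr (_ + _); rewrite -[RHS](modn_small (d := y.+1)) //.
by rewrite -[in RHS](modnMDl q); congr (_ %% _); lia.
Qed.

(** The value lies in the block of length [y + 1] starting at ['C(y.+1, 2)], and these blocks are
    disjoint. *)
Lemma vval_inj m y m' y' : vval m y = vval m' y' -> y = y'.
Proof. by apply: triangular_block_inj; rewrite -ltnS ltn_pmod. Qed.

Lemma sum_between (p : nat) (l u : 'I_p -> nat) t :
    (forall i, l i <= u i) -> \sum_i l i <= t <= \sum_i u i ->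
  exists f : 'I_p -> nat, (forall i, l i <= f i <= u i) /\ \sum_i f i = t.
Proof.
move=> lu ht; pose fin (g : 'I_p -> nat) : position 'I_p := [ffun i => g i].
have finE g : \sum_i fin g i = \sum_i g i by apply: eq_bigr => i _; rewrite ffunE.
have [x i|i||w [lw wu <-]] :=
    @position_ivt _ (fun x : position 'I_p => \sum_i x i) (fin l) (fin u) t.
- rewrite (bigD1 i) //= [X in _ <= X.+1](bigD1 i) //= ffunE set11 -addSn leq_add //.
    by rewrite subn1 leqSpred.
  by apply: leq_sum => j /negPf ji; rewrite ffunE inE ji subn0.
- by rewrite !ffunE.
- by rewrite !finE.
by exists w; split=> // i; move: (lw i) (wu i); rewrite !ffunE => -> ->.
Qed.

(** * Moves of the selective compound *)

Section Compound.

Variables (p : nat) (V : 'I_p -> finType) (H : forall i, {set {set V i}}).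
Hypotheses (hyperH : forall i, hypergraph (H i)) (jmH : forall i, JMplus (H i)).

Local Notation T := {i : 'I_p & V i}.
Local Notation tag_ := (Tagged (fun i => V i : Type)).
Implicit Types x w : position T.

Definition assemble (f : forall i, position (V i)) : position T :=
  [ffun u => f (tag u) (tagged u)].

Lemma component_assemble f i : component (assemble f) i = f i.
Proof. by apply/ffunP => v; rewrite !ffunE. Qed.

Lemma position_ext x w : (forall i, component w i = component x i) -> w = x.
Proof.
move=> e; apply/ffunP => -[i v].
have := congr1 (fun g : position (V i) => g v) (e i).
by rewrite !ffunE.
Qed.

Lemma mem_bigcup_tag (F : forall i, {set V i}) i v :
  (tag_ v \in \bigcup_j [set tag_ u | u in F j]) = (v \in F i).
Proof.
apply/bigcupP/idP => [[j _ /imsetP[u uF e]]|vF]; last first.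
  by exists i => //; apply: imset_f.
have eij : i = j by have := congr1 tag e.
by subst j; move/eqP: e; rewrite eq_Tagged => /eqP /= ->.
Qed.

Lemma compound_set0 : set0 \notin selective_compound H.
Proof. by rewrite /selective_compound !inE eqxx. Qed.

(** Choosing the empty set in a component means passing there; excluding [set0] from the compound
    amounts to [w <> x]. *)
Lemma compound_moveP x w :
  move (selective_compound H) x w <->
    (forall i, reach (H i) (component x i) (component w i)) /\ w <> x.
Proof.
split=> [xw|[xw wx]].
  split=> [i|e]; last by have := move_irrefl compound_set0 x; rewrite -{2}e xw.
  case/moveP: xw => D; rewrite !inE => /andP[_ /imsetP[F /setXnP FH ->]] Dxw.
  move: (FH i); rewrite !inE => /predU1P[F0|FiH].
    left; apply/ffunP => v; rewrite !ffunE.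
    by move: (Dxw (tag_ v)); rewrite mem_bigcup_tag F0 inE => /eqP.
  right; apply/moveP; exists (F i) => // v; rewrite !ffunE.
  by move: (Dxw (tag_ v)); rewrite mem_bigcup_tag.
have /fin_all_exists[F FP] i : exists E, E \in set0 |: H i /\
    move_by E (component x i) (component w i).
  case: (xw i) => [->|/moveP[E EH Exw]]; last by exists E; rewrite !inE EH orbT.
  by exists set0; split=> [|v]; rewrite !inE eqxx.
pose D := \bigcup_i [set tag_ u | u in F i].
have Dxw : move_by D x w.
  by case=> i v; rewrite mem_bigcup_tag; have := (FP i).2 v; rewrite !ffunE.
apply/moveP; exists D => //; rewrite !inE; apply/andP; split.
  apply/eqP => D0; apply: wx; apply/ffunP => u.
  by move: (Dxw u); rewrite D0 inE => /eqP.
apply/imsetP; exists [ffun i => F i] => [|]; last first.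
  by apply: eq_bigr => i _; rewrite ffunE.
by apply/setXnP => i; rewrite ffunE; have [] := FP i.
Qed.

Definition totM x := \sum_i minpos (component x i).
Definition totY x := \sum_i yval (H i) (component x i).
Definition totH x := \sum_i height (H i) (component x i).

Lemma compound_reach x (P : forall i, position (V i) -> Prop) :
    (forall i, exists u, reach (H i) (component x i) u /\ P i u) ->
  exists w, (forall i, reach (H i) (component x i) (component w i)) /\
            (forall i, P i (component w i)).
Proof.
case/fin_all_exists => f fP; exists (assemble f).
by split=> i; rewrite component_assemble; have [] := fP i.
Qed.

(** First [K], then [t], is distributed over the components within the bounds of [reach_min_yval];
    the last hypothesis excludes [w = x]. *)
Lemma compound_move_exists x K t :
    K <= totM x -> K <= t <= totY x -> (0 < K) || (t < totY x) ->
  exists w, [/\ move (selective_compound H) x w, totM w = totM x - K & totY w = t].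
Proof.
move=> KM /andP[Kt tY] neq.
have [||k [kP sk]] := @sum_between p (fun=> 0) (fun i => minpos (component x i)) K.
- by [].
- by rewrite big1.
have [||y [yP sy]] :=
    @sum_between p k (fun i => maxn (k i) (yval (H i) (component x i))) t.
- by move=> i; apply: leq_maxl.
- rewrite sk Kt (leq_trans tY) //; apply: leq_sum => i _; apply: leq_maxr.
have [i|w [xw wP]] := @compound_reach x (fun i u =>
    minpos u = minpos (component x i) - k i /\ yval (H i) u = y i).
  have /andP[_ ki] := kP i.
  by have [w [? ? ?]] := reach_min_yval (hyperH i) (jmH i) ki (yP i); exists w.
have wM : totM w = totM x - K.
  rewrite -sk -sumnB => [|i _]; last by have /andP[] := kP i.
  by apply: eq_bigr => i _; have [] := wP i.
have wY : totY w = t by rewrite -sy; apply: eq_bigr => i _; have [] := wP i.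
exists w; split=> //; apply/compound_moveP; split=> // e.
by rewrite e in wM wY; lia.
Qed.

(** With [a i] the thresholds of [reach_heights], [t] is distributed with all shares above them or
    all below, according to its comparison with their sum. *)
Lemma compound_height_exists x t :
    totM x <= t < totH x ->
  exists w, [/\ move (selective_compound H) x w, totH w = t
               & totM w = 0 \/ totY x <= totY w].
Proof.
case/andP=> Mt tH.
have /fin_all_exists[a aP] i := reach_heights (hyperH i) (jmH i) (component x i).
have neq w : (forall i, reach (H i) (component x i) (component w i)) ->
    totH w = t -> move (selective_compound H) x w.
  by move=> xw wt; apply/compound_moveP; split=> // e; rewrite -wt e ltnn in tH.
have [a_t|t_a] := leqP (\sum_i a i) t.
  have [||h [hP sh]] := @sum_between p a (fun i => height (H i) (component x i)) t.
  - by move=> i; have [/andP[]] := aP i.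
  - by rewrite a_t ltnW.
  have [i|w [xw wP]] := @compound_reach x (fun i u =>
      height (H i) u = h i /\ yval (H i) (component x i) <= yval (H i) u).
    by have [_ /(_ _ (hP i))[w [? ? ?]] _] := aP i; exists w.
  have wt : totH w = t by rewrite -sh; apply: eq_bigr => i _; have [] := wP i.
  exists w; split=> //; first exact: neq.
  by right; apply: leq_sum => i _; have [] := wP i.
have [||h [hP sh]] := @sum_between p (fun i => minpos (component x i)) a t.
- by move=> i; have [/andP[]] := aP i.
- by rewrite Mt ltnW.
have [i|w [xw wP]] := @compound_reach x (fun i u =>
    height (H i) u = h i /\ minpos u = 0).
  by have [_ _ /(_ _ (hP i))[w [? ? ?]]] := aP i; exists w.
have wt : totH w = t by rewrite -sh; apply: eq_bigr => i _; have [] := wP i.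
exists w; split=> //; first exact: neq.
by left; apply: big1 => i _; have [] := wP i.
Qed.

Lemma tot_height x : totY x + (totM x).*2 <= totH x.
Proof.
rewrite -addnn /totY /totM -!big_split; apply: leq_sum => i _ /=.
by rewrite addnn; apply: yval_minpos_height.
Qed.

Lemma compound_move_bounds x w : move (selective_compound H) x w ->
  [/\ totM w <= totM x, totH w < totH x, totM x <= totM w + totY w
    & totM w = totM x -> totY w < totY x].
Proof.
case/compound_moveP => xw wx.
have [i ne_i] : exists i, component w i != component x i.
  apply/existsP; apply: contraT; rewrite negb_exists => /forallP e.
  by case: wx; apply: position_ext => i; have /negPn/eqP := e i.
have mv_i : move (H i) (component x i) (component w i).
  by case: (xw i) => // e; rewrite e eqxx in ne_i.
have leM j : minpos (component w j) <= minpos (component x j).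
  exact: reach_minpos (xw j).
split.
- exact: leq_sum.
- rewrite /totH (bigD1 i) //= [ltnRHS](bigD1 i) //= -addSn leq_add //.
    exact: move_height (hyperH i).1 _ _ mv_i.
  by apply: leq_sum => j _; apply: reach_height.
- by rewrite -big_split; apply: leq_sum => j _; apply: reach_minpos_yval.
(* No component minimum increases, so equal sums force equality in each component. *)
move=> eM; have eMj j : minpos (component w j) = minpos (component x j).
  apply/eqP; rewrite eqn_leq leM leqNgt; apply/negP => lt_j.
  suff : totM w < totM x by rewrite eM ltnn.
  rewrite /totM (bigD1 j) //= [ltnRHS](bigD1 j) //= -addSn leq_add //.
  exact: leq_sum.
rewrite /totY (bigD1 i) //= [ltnRHS](bigD1 i) //= -addSn leq_add //.
  exact: move_yval.
apply: leq_sum => j _; case: (xw j) => [-> //|mv_j].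
exact/ltnW/move_yval.
Qed.

(** * The two mex conditions for [totU] *)

Definition totU x := calU (totM x) (totY x) (totH x).

Lemma totU_move x w : move (selective_compound H) x w -> totU w != totU x.
Proof.
move=> xw; have [leM ltH MY eqM] := compound_move_bounds xw; apply/eqP.
rewrite /totU /calU; have hx := tot_height x; have hw := tot_height w.
(* Two long positions differ in height. In the mixed cases the short value is below [totM x], which
   is at most either height. Only short to short remains. *)
have [wl|/[dup] wsh /vval_lt wv] := leqP;
  have [xl|/[dup] xsh /vval_lt xv] := leqP; try lia.
move=> e; have eY := vval_inj e; move: e; rewrite /vval eY => /addnI/eqP.
rewrite -[_ == _]/(_ == _ %[mod (totY x).+1]) => emod.
rewrite eY in wsh; have {emod} : (totY x).+1 %| totM x - totM w.
  move: emod; rewrite eq_sym eqn_mod_dvd; last lia.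
  by congr (_ %| _); lia.
(* The difference is at most [totY w = totY x], so as a multiple of [(totY x).+1] it is 0; then
   [totY] would have to drop. *)
have [e|ne] := posnP (totM x - totM w).
  have eMM : totM w = totM x by lia.
  by have := eqM eMM; rewrite eY ltnn.
by move/(dvdn_leq ne); lia.
Qed.

Lemma totU_lt x t : t < totU x ->
  exists2 w, move (selective_compound H) x w & totU w = t.
Proof.
move=> tU; have [tM|Mt] := ltnP t (totM x); last first.
  have [xl|xsh] := leqP (totM x) 'C((totY x).+1, 2); last first.
    by move: tU (vval_lt xsh); rewrite /totU /calU (ltn_geF xsh); lia.
  have tH : t < totH x by move: tU; rewrite /totU /calU xl.
  have [|w [xw wt wl]] := @compound_height_exists x t; first by rewrite Mt.
  exists w => //; rewrite /totU /calU ifT //; case: wl => [-> //|Yw].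
  have [leM _ _ _] := compound_move_bounds xw.
  exact: leq_trans leM (leq_trans xl (triangular_mono Yw)).
have [y [r [ry et]]] := triangular_block t.
(* [totM x - K] is the largest number up to [totM x] congruent to [t + 1]. *)
pose N := totM x - t.+1; pose K := N %% y.+1; pose q := N %/ y.+1.
have Ky : K <= y by rewrite -ltnS ltn_pmod.
have eM : totM x = t.+1 + q * y.+1 + K.
  by rewrite -addnA -divn_eq subnKC.
(* Otherwise [t] exceeds ['C((totY x).+1, 2) + totY x], contradicting [t < totM x] for long [x] and
   [t < totU x] for short [x]. *)
have yY : y <= totY x.
  rewrite leqNgt; apply/negP => /triangular_ltn; move: tU; rewrite /totU /calU.
  case: (leqP (totM x)) => [|_]; first lia.
  have := ltn_pmod (totM x - 'C((totY x).+1, 2) - 1) (ltn0Sn (totY x)).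
  by rewrite /vval; move: (_ %% _) => e; lia.
(* If [K = 0] and [y = totY x], then [totU x] would already be [t]. *)
have ne : (0 < K) || (y < totY x).
  rewrite lt0n ltn_neqAle yY andbT -negb_and; apply/negP => /andP[/eqP K0 /eqP eY].
  by move: tU; rewrite /totU eM K0 addn0 -eY et calU_short // ltnn.
have [|||w [xw wM wY]] := @compound_move_exists x K y; rewrite ?Ky ?yY //; first lia.
by exists w => //; rewrite /totU wM wY eM addnK et calU_short.
Qed.

Lemma compound_grundy x : grundy (selective_compound H) x = totU x.
Proof.
exact: grundy_unique compound_set0 totU_move totU_lt x.
Qed.

End Compound.

Theorem theorem2 (p : nat) (hp : 1 <= p) (V : 'I_p -> finType)
    (H : forall i : 'I_p, {set {set V i}})
    (hyperH : forall i : 'I_p, hypergraph (H i))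
    (jmH : forall i : 'I_p, JMplus (H i))
    (x : position {i : 'I_p & V i}) :
  grundy (selective_compound H) x =
  calU (\sum_(i < p) minpos (component x i))
       (\sum_(i < p) yval (H i) (component x i))
       (\sum_(i < p) height (H i) (component x i)).
Proof. exact: compound_grundy. Qed.
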